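(* Let $F$ be an algebraically closed field of characteristic zero, $n\ge 2$, and $F[[X]]=F[[x_1,\dots,x_n]]$. Let $(A,t)$ be a trace extension of $F[[X]]$. Then $(A,t)$ is isomorphic to the trivial extension of $F[[X]]$.
   Context: Let $M$ be the maximal ideal of $F[[X]]$. A distribution on $F[[X]]$ is a linear functional $f:F[[X]]\to F$ with $f(M^m)=(0)$ for some $m\ge1$. A trace extension of $F[[X]]$ is a pair $(A,t)$, where $A\supseteq F[[X]]$ is an associative commutative unital $F$-algebra and $t:A\to F$ is a linear functional such that: the bilinear form $(a|b)=t(ab)$ on $A$ is nondegenerate; $F[[X]]^\perp=\{a\in A:(F[[X]]|a)=(0)\}=F[[X]]$; for every distribution $f$ on $F[[X]]$ there exists $a\in A$ with $f(b)=(b|a)$ for all $b\in F[[X]]$. Two trace extensions $(A,t)$ and $(A',t')$ are isomorphic if there is an algebra isomorphism $g:A\to A'$ identical on $F[[X]]$ and a nonzero scalar $\xi\in F$ such that $t'(g(a))=\xi t(a)$ for all $a\in A$. The trivial extension is $F[[X]]\oplus\bigoplus_{\alpha\in\mathbb Z_{\ge0}^n}Fa_\alpha$ with multiplication extending that of $F[[X]]$ and determined by $a_\alpha a_\beta=0$, $a_\alpha x^\beta=a_{\alpha-\beta}$ if $\alpha\ge\beta$ componentwise and $a_\alpha x^\beta=0$ otherwise (and $a_\alpha h=0$ for $h\in M^{m}$ with $m>\alpha_1+\dots+\alpha_n$), where $x^\beta=x_1^{\beta_1}\cdots x_n^{\beta_n}$; its trace satisfies $t(a_0)=1$, $t(a_\alpha)=0$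 for $\alpha\ne0$, $t(F[[X]])=0$.
   Formalization: The formal theorem also assumes that for every a in A the functional b ↦ (b|a) on F[[X]] is a distribution; without this the claim fails, e.g. for F[[X]] ⊕ V with V the full algebraic dual and V²=0, and the conclusion itself forces it. *)

(* Defs.v *)
From HB Require Import structures.
From mathcomp Require Import all_boot all_order all_algebra.
From mathcomp Require Import boolp.
From mathcomp Require Import ssrcomplements mpoly.
From mathcomp Require Import zify.

Set Implicit Arguments.
Unset Strict Implicit.
Unset Printing Implicit Defensive.

Import GRing.Theory.

Local Open Scope ring_scope.

Record fps (R : Type) (n : nat) := FPS { fcoef : 'X_{1..n} -> R }.

Arguments FPS {R n}.
Arguments fcoef {R n}.

HB.instance Definition _ (R : Type) (n : nat) :=
  gen_eqMixin (fps R n).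
HB.instance Definition _ (R : Type) (n : nat) :=
  gen_choiceMixin (fps R n).

Section FPSRing.
Variables (R : comNzRingType) (n : nat).
Implicit Types f g h : fps R n.

Lemma fpsP f g : (forall m, fcoef f m = fcoef g m) -> f = g.
Proof. by case: f g => [f] [g] /= E; congr FPS; apply/funext. Qed.

Definition fps_zero : fps R n := FPS (fun=> 0).
Definition fps_add f g : fps R n := FPS (fun m => fcoef f m + fcoef g m).
Definition fps_opp f : fps R n := FPS (fun m => - fcoef f m).

Fact fps_addA : associative fps_add.
Proof. by move=> f g h; apply: fpsP => m /=; rewrite addrA. Qed.
Fact fps_addC : commutative fps_add.
Proof. by move=> f g; apply: fpsP => m /=; rewrite addrC. Qed.
Fact fps_add0 : left_id fps_zero fps_add.
Proof. by move=> f; apply: fpsP => m /=; rewrite add0r. Qed.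
Fact fps_addN : left_inverse fps_zero fps_opp fps_add.
Proof. by move=> f; apply: fpsP => m /=; rewrite addNr. Qed.

HB.instance Definition _ := GRing.isZmodule.Build (fps R n)
  fps_addA fps_addC fps_add0 fps_addN.

(* The index set is exactly the set of pairs (k_1, k_2) with k_1 + k_2 = m:
   both components have degree at most that of m. *)
Definition fps_mul f g : fps R n :=
  FPS (fun m => \sum_(k : 'X_{1..n < (mdeg m).+1, (mdeg m).+1}
                       | m == (k.1 + k.2)%MM) fcoef f k.1 * fcoef g k.2).

Definition fps_X (b : 'X_{1..n}) : fps R n := FPS (fun m => (m == b)%:R).

Definition fps_trunc d f : {mpoly R[n]} :=
  \sum_(m : 'X_{1..n < d}) fcoef f m *: 'X_[m].

Lemma fps_truncE d f m : (mdeg m < d)%N -> (fps_trunc d f)@_m = fcoef f m.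
Proof. exact: mcoeff_mpoly. Qed.

Lemma fps_mulE d f g m : (mdeg m < d)%N ->
  fcoef (fps_mul f g) m = (fps_trunc d f * fps_trunc d g)@_m.
Proof.
move=> md; rewrite mcoeffM; apply: eq_bigr => -[[k1 /= h1] [k2 /= h2]] _.
by rewrite !fps_truncE //; apply: leq_trans md.
Qed.

Lemma fps_mul_linE d f g m : (mdeg m < d)%N -> fcoef (fps_mul f g) m =
  \sum_(k : 'X_{1..n < d} | (k <= m)%MM) fcoef f k * fcoef g (m - k)%MM.
Proof.
move=> md; rewrite (fps_mulE _ _ md) (mcoeff_poly_mul_lin _ _ md).
apply: eq_bigr => -[k /= hk] _; rewrite !fps_truncE //.
by apply: leq_ltn_trans md; apply: mdegB.
Qed.

Fact fps_mulA : associative fps_mul.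
Proof.
move=> f g h; apply: fpsP => m.
pose t := fps_trunc (mdeg m).+1.
transitivity ((t f * (t g * t h))@_m).
  rewrite mcoeffM; apply: eq_bigr => -[[k1 h1] [k2 h2]] _ /=.
  by congr (_ * _); [rewrite fps_truncE | exact: fps_mulE].
rewrite mulrA mcoeffM; apply: eq_bigr => -[[k1 h1] [k2 h2]] _ /=.
by congr (_ * _); [apply/esym; exact: fps_mulE | rewrite fps_truncE].
Qed.

Fact fps_mulC : commutative fps_mul.
Proof.
by move=> f g; apply: fpsP => m; rewrite !(fps_mulE _ _ (ltnSn _)) mulrC.
Qed.

Fact fps_mulDl : left_distributive fps_mul +%R.
Proof.
move=> f g h; apply: fpsP => m; rewrite /= -big_split /=.
by apply: eq_bigr => k _; rewrite mulrDl.
Qed.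

Fact fps_mul1 : left_id (fps_X 0%MM) fps_mul.
Proof.
move=> f; apply: fpsP => m; rewrite (fps_mul_linE _ _ (ltnSn _)).
have h0 : (mdeg (0%MM : 'X_{1..n}) < (mdeg m).+1)%N by rewrite mdeg0.
rewrite (bigD1 (BMultinom h0)) /=; last first.
  by apply/mnm_lepP => i; rewrite mnm0E.
rewrite eqxx mul1r subm0 big1 ?addr0 // => k /andP[_ nz].
rewrite -val_eqE in nz; rewrite (_ : (_ == _) = false) ?mul0r //.
exact: negbTE nz.
Qed.

Fact fps_1_neq0 : fps_X 0%MM != 0.
Proof.
apply/eqP => /(congr1 (fun f => fcoef f 0%MM)) /= /eqP.
by rewrite eqxx oner_eq0.
Qed.

HB.instance Definition _ := GRing.Zmodule_isComNzRing.Build (fps R n)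
  fps_mulA fps_mulC fps_mul1 fps_mulDl fps_1_neq0.

Definition fps_scale (c : R) f : fps R n := FPS (fun m => c * fcoef f m).

Fact fps_scaleA a b f : fps_scale a (fps_scale b f) = fps_scale (a * b) f.
Proof. by apply: fpsP => m /=; rewrite mulrA. Qed.
Fact fps_scale1 : left_id 1 fps_scale.
Proof. by move=> f; apply: fpsP => m /=; rewrite mul1r. Qed.
Fact fps_scaleDr : right_distributive fps_scale +%R.
Proof. by move=> a f g; apply: fpsP => m /=; rewrite mulrDr. Qed.
Fact fps_scaleDl f : {morph fps_scale^~ f : a b / a + b}.
Proof. by move=> a b; apply: fpsP => m /=; rewrite mulrDl. Qed.

HB.instance Definition _ := GRing.Zmodule_isLmodule.Build R (fps R n)
  fps_scaleA fps_scale1 fps_scaleDr fps_scaleDl.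

Fact fps_scaleAl (a : R) f g : a *: (f * g) = (a *: f) * g.
Proof.
apply: fpsP => m; rewrite /= big_distrr /=.
by apply: eq_bigr => k _; rewrite mulrA.
Qed.

HB.instance Definition _ := GRing.Lmodule_isLalgebra.Build R (fps R n)
  fps_scaleAl.
HB.instance Definition _ := GRing.Lalgebra_isComAlgebra.Build R (fps R n).

Lemma fcoefD f g m : fcoef (f + g) m = fcoef f m + fcoef g m.
Proof. by []. Qed.

Lemma fcoefZ c f m : fcoef (c *: f) m = c * fcoef f m.
Proof. by []. Qed.

Lemma fcoef1 m : fcoef (1 : fps R n) m = (m == 0%MM)%:R.
Proof. by []. Qed.

Lemma fcoefM f g d m : (mdeg m < d)%N -> fcoef (f * g) m =
  \sum_(k : 'X_{1..n < d} | (k <= m)%MM) fcoef f k * fcoef g (m - k)%MM.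
Proof. exact: fps_mul_linE. Qed.

End FPSRing.

Arguments fps_X {R n}.

Definition ideal_power (R : comNzRingType) (I : pred R) (m : nat) (x : R) :
    Prop :=
  exists2 s : seq (R * m.-tuple R),
    {in s, forall u : R * m.-tuple R, all I u.2} & x = \sum_(u <- s) u.1 * \prod_(y <- u.2) y.

(* Over a field, the maximal ideal of the local ring of formal power series
   consists of the series without constant term. *)
Definition fps_max (F : fieldType) (n : nat) : pred (fps F n) :=
  fun f => fcoef f 0%MM == 0.
Arguments fps_max {F n}.

Definition distribution (F : fieldType) (n : nat) (f : fps F n -> F) : Prop :=
  scalar f /\
  exists2 m, (1 <= m)%N & forall h, ideal_power fps_max m h -> f h = 0.

(* The inclusion of F[[X]] in A is rendered by an injective algebra morphism. *)
Record traced_ext (F : fieldType) (n : nat) := TracedExt {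
  te_alg :> comAlgType F;
  te_inj : {lrmorphism fps F n -> te_alg};
  te_injI : injective te_inj;
  te_tr : {scalar te_alg}
}.

Section TraceExtension.
Variables (F : fieldType) (n : nat).

Definition te_form (A : traced_ext F n) (a b : A) : F := te_tr A (a * b).

Definition trace_extension (A : traced_ext F n) : Prop :=
  [/\ forall a : A, (forall b, te_form a b = 0) -> a = 0,
      forall a : A, (forall h, te_form (te_inj A h) a = 0) <->
                    exists h, a = te_inj A h
    & forall f, distribution f ->
        exists a : A, forall h, f h = te_form (te_inj A h) a].

(* The converse of the third clause: every functional (. | a) restricted to
   F[[X]] is a distribution.  It does not follow from [trace_extension]: let
   V be the full algebraic dual of F[[X]], and let A be the sum of F[[X]] and
   V with V ^ 2 = 0, (h v)(k) = v (h k) and t (h + v) = v 1.  Then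
   (h + v | k + w) = w h + v k, so that A is a trace extension, although V
   contains functionals which vanish on no power of the maximal ideal. *)
Definition distributional (A : traced_ext F n) : Prop :=
  forall a : A, distribution (fun h => te_form (te_inj A h) a).

Definition te_iso (A B : traced_ext F n) : Prop :=
  exists (g : {lrmorphism A -> B}) (xi : F),
    [/\ bijective g, forall h, g (te_inj A h) = te_inj B h, xi != 0
      & forall a, te_tr B (g a) = xi * te_tr A a].

End TraceExtension.

Section TrivialExtension.
Variables (F : fieldType) (n : nat).
Implicit Types (f g h : fps F n) (d e : {mpoly F[n]}).

(* {mpoly F[n]} is only used as the vector space with basis indexed by
   'X_{1..n}; the basis vector a_alpha is 'X_[alpha].  The product of f and
   a_alpha is the sum of the f_beta a_(alpha - beta) for beta <= alpha. *)
Definition actX f (alpha : 'X_{1..n}) : {mpoly F[n]} :=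
  \sum_(beta : 'X_{1..n < (mdeg alpha).+1} | (beta <= alpha)%MM)
    fcoef f beta *: 'X_[alpha - beta].

Definition act f d : {mpoly F[n]} :=
  \sum_(alpha <- msupp d) d@_alpha *: actX f alpha.

Lemma actE k f d : (msize d <= k)%N ->
  act f d = \sum_(alpha : 'X_{1..n < k}) d@_alpha *: actX f alpha.
Proof.
move=> le_dk; pose I : subFinType _ := 'X_{1..n < k}.
rewrite /act (big_mksub I) ?msupp_uniq //=; first last.
  by move=> x /msize_mdeg_lt /leq_trans; apply.
by rewrite big_rmcond //= => j /memN_msupp_eq0 ->; rewrite scale0r.
Qed.

Fact act_is_linear f : linear (act f).
Proof.
move=> c d e; set k := maxn (msize (c *: d + e)) (maxn (msize d) (msize e)).
rewrite !(@actE k) ?leq_max ?leqnn ?orbT //.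
rewrite scaler_sumr -big_split /=; apply: eq_bigr => m _.
by rewrite mcoeffD mcoeffZ scalerDl scalerA.
Qed.

HB.instance Definition _ f :=
  GRing.isLinear.Build F {mpoly F[n]} {mpoly F[n]} _ (act f) (act_is_linear f).

Lemma act_X f alpha : act f 'X_[alpha] = actX f alpha.
Proof. by rewrite /act msuppX big_seq1 mcoeffX eqxx scale1r. Qed.

Lemma mcoeff_actX f alpha gamma :
  (actX f alpha)@_gamma =
    if (gamma <= alpha)%MM then fcoef f (alpha - gamma)%MM else 0.
Proof.
rewrite /actX raddf_sum /=.
under eq_bigr do rewrite mcoeffZ mcoeffX.
case: ifP => [le_ga|nle_ga].
  have h : (mdeg (alpha - gamma)%MM < (mdeg alpha).+1)%N.
    by rewrite ltnS mdegB.
  rewrite (bigD1 (BMultinom h)) /=; last first.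
    by apply/mnm_lepP => i; rewrite mnmBE leq_subr.
  have subK (b : 'X_{1..n}) : (b <= alpha)%MM -> (alpha - (alpha - b))%MM = b.
    by move=> le; apply/mnmP => i; rewrite !mnmBE subKn //; apply/mnm_lepP.
  rewrite subK // eqxx mulr1 big1 ?addr0 // => b /andP[le_b].
  rewrite -val_eqE /= => ne_b; case: eqP => [e|_]; last by rewrite mulr0.
  by move: ne_b; rewrite -e subK ?eqxx.
rewrite big1 // => b le_b; case: eqP => [e|_]; last by rewrite mulr0.
move: nle_ga; rewrite -e => /negP[]; apply/mnm_lepP => i.
by rewrite mnmBE leq_subr.
Qed.

Lemma act_ind (P Q : {linear {mpoly F[n]} -> {mpoly F[n]}}) :
  (forall m, P 'X_[m] = Q 'X_[m]) -> P =1 Q.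
Proof.
move=> PQ d; rewrite [d]mpolyE !linear_sum /=.
by apply: eq_bigr => m _; rewrite !linearZ /= PQ.
Qed.

Lemma actDl f g d : act (f + g) d = act f d + act g d.
Proof.
apply: (@act_ind (act (f + g)) (act f \+ act g)) => m /=; rewrite !act_X.
by apply/mpolyP => c; rewrite mcoeffD !mcoeff_actX; case: ifP; rewrite ?addr0.
Qed.

Lemma actZl c f d : act (c *: f) d = c *: act f d.
Proof.
apply: (@act_ind (act (c *: f)) (c \*: act f)) => m /=; rewrite !act_X.
by apply/mpolyP => a; rewrite mcoeffZ !mcoeff_actX; case: ifP; rewrite ?mulr0.
Qed.

Lemma actZr c f d : act f (c *: d) = c *: act f d.
Proof. exact: linearZ. Qed.

Lemma act1 d : act 1 d = d.
Proof.
apply: (@act_ind (act 1) idfun) => m /=; rewrite !act_X.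
apply/mpolyP => a; rewrite mcoeff_actX mcoeffX fcoef1.
case: ifP => le_am.
  congr (_%:R); congr nat_of_bool; apply/eqP/eqP => [E|->].
    by rewrite -(submK le_am) E add0m.
  by apply/mnmP => i; rewrite mnmBE subnn mnm0E.
by case: eqP => // E; move: le_am; rewrite E lepm_refl.
Qed.

Lemma actA f g d : act f (act g d) = act (f * g) d.
Proof.
rewrite mulrC.
apply: (@act_ind (act f \o act g) (act (g * f))) => m /=.
rewrite !act_X {1}/actX linear_sum /=; apply/mpolyP => c.
rewrite raddf_sum mcoeff_actX /=.
under eq_bigr do rewrite linearZ /= mcoeffZ act_X mcoeff_actX.
case: ifP => le_cm; last first.
  rewrite big1 // => b _; case: ifP => [le|]; last by rewrite mulr0.
  move: le_cm => /negP[]; apply: (lepm_trans le).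
  by apply/mnm_lepP => i; rewrite mnmBE leq_subr.
have h : (mdeg (m - c)%MM < (mdeg m).+1)%N by rewrite ltnS mdegB.
apply: (etrans _ (esym (fcoefM g f h))).
rewrite big_mkcond [RHS]big_mkcond /=; apply: eq_bigr => b _.
have -> : (b <= m - c)%MM = (b <= m)%MM && (c <= m - b)%MM.
  apply/mnm_lepP/andP => [le|[/mnm_lepP le1 /mnm_lepP le2] i].
    by split; apply/mnm_lepP => i; move: (le i) (elimT mnm_lepP le_cm i);
       rewrite !mnmBE; lia.
  by move: (le1 i) (le2 i); rewrite !mnmBE; lia.
case: ifP => //= _; case: ifP => _; last by rewrite mulr0.
by congr (_ * fcoef f _); apply/mnmP => i; rewrite !mnmBE subnAC.
Qed.

Record triv_alg := TrivAlg { triv_ser : fps F n; triv_dual : {mpoly F[n]} }.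

Implicit Types u v w : triv_alg.

HB.instance Definition _ := gen_eqMixin triv_alg.
HB.instance Definition _ := gen_choiceMixin triv_alg.

Definition triv_zero := TrivAlg 0 0.
Definition triv_add u v :=
  TrivAlg (triv_ser u + triv_ser v) (triv_dual u + triv_dual v).
Definition triv_opp u := TrivAlg (- triv_ser u) (- triv_dual u).

Fact triv_addA : associative triv_add.
Proof. by move=> u v w; congr TrivAlg; rewrite /= addrA. Qed.
Fact triv_addC : commutative triv_add.
Proof. by move=> u v; congr TrivAlg; rewrite /= addrC. Qed.
Fact triv_add0 : left_id triv_zero triv_add.
Proof. by move=> [f d]; congr TrivAlg; rewrite /= add0r. Qed.
Fact triv_addN : left_inverse triv_zero triv_opp triv_add.
Proof. by move=> u; congr TrivAlg; rewrite /= addNr. Qed.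

HB.instance Definition _ := GRing.isZmodule.Build triv_alg
  triv_addA triv_addC triv_add0 triv_addN.

Definition triv_one := TrivAlg 1 0.
Definition triv_mul u v :=
  TrivAlg (triv_ser u * triv_ser v)
          (act (triv_ser u) (triv_dual v) + act (triv_ser v) (triv_dual u)).

Fact triv_mulA : associative triv_mul.
Proof.
move=> u v w; congr TrivAlg => /=; first by rewrite mulrA.
by rewrite !linearD /= !actA addrA !(mulrC (triv_ser w)).
Qed.

Fact triv_mulC : commutative triv_mul.
Proof. by move=> u v; congr TrivAlg; rewrite /= (mulrC, addrC). Qed.

Fact triv_mul1 : left_id triv_one triv_mul.
Proof.
by move=> [f d]; congr TrivAlg; rewrite /= ?mul1r // act1 linear0 addr0.
Qed.

Fact triv_mulDl : left_distributive triv_mul +%R.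
Proof.
move=> u v w; congr TrivAlg => /=; first by rewrite mulrDl.
by rewrite actDl linearD /= addrACA.
Qed.

Fact triv_1_neq0 : triv_one != 0.
Proof. by apply/eqP => /(congr1 triv_ser) /eqP; rewrite oner_eq0. Qed.

HB.instance Definition _ := GRing.Zmodule_isComNzRing.Build triv_alg
  triv_mulA triv_mulC triv_mul1 triv_mulDl triv_1_neq0.

Definition triv_scale (c : F) u :=
  TrivAlg (c *: triv_ser u) (c *: triv_dual u).

Fact triv_scaleA a b u : triv_scale a (triv_scale b u) = triv_scale (a * b) u.
Proof. by congr TrivAlg; rewrite /= scalerA. Qed.
Fact triv_scale1 : left_id 1 triv_scale.
Proof. by move=> [f d]; congr TrivAlg; rewrite /= scale1r. Qed.
Fact triv_scaleDr : right_distributive triv_scale +%R.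
Proof. by move=> c u v; congr TrivAlg; rewrite /= scalerDr. Qed.
Fact triv_scaleDl u : {morph triv_scale^~ u : a b / a + b}.
Proof. by move=> a b; congr TrivAlg; rewrite /= scalerDl. Qed.

HB.instance Definition _ := GRing.Zmodule_isLmodule.Build F triv_alg
  triv_scaleA triv_scale1 triv_scaleDr triv_scaleDl.

Fact triv_scaleAl (c : F) u v : c *: (u * v) = (c *: u) * v.
Proof.
congr TrivAlg => /=; first by rewrite scalerAl.
by rewrite actZl actZr scalerDr.
Qed.

HB.instance Definition _ := GRing.Lmodule_isLalgebra.Build F triv_alg
  triv_scaleAl.
HB.instance Definition _ := GRing.Lalgebra_isComAlgebra.Build F triv_alg.

Definition triv_inj f := TrivAlg f 0.

Fact triv_inj_is_linear : linear triv_inj.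
Proof. by move=> c f g; congr TrivAlg; rewrite /= scaler0 addr0. Qed.

Fact triv_inj_is_monoid_morphism : monoid_morphism triv_inj.
Proof. by split=> // f g; congr TrivAlg; rewrite /= !linear0 addr0. Qed.

HB.instance Definition _ := GRing.isLinear.Build F (fps F n) triv_alg _
  triv_inj triv_inj_is_linear.
HB.instance Definition _ := GRing.isMonoidMorphism.Build (fps F n) triv_alg
  triv_inj triv_inj_is_monoid_morphism.

Fact triv_injI : injective triv_inj.
Proof. by move=> f g []. Qed.

Definition triv_tr u : F := (triv_dual u)@_0%MM.

Fact triv_tr_is_linear : scalar triv_tr.
Proof. by move=> c u v; rewrite /triv_tr /= mcoeffD mcoeffZ. Qed.

HB.instance Definition _ := GRing.isLinear.Build F triv_alg F _
  triv_tr triv_tr_is_linear.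

Definition trivial_ext : traced_ext F n :=
  @TracedExt F n triv_alg triv_inj triv_injI triv_tr.

Definition triv_a (alpha : 'X_{1..n}) := TrivAlg 0 'X_[alpha].

Lemma triv_a_mul alpha beta : triv_a alpha * triv_a beta = 0.
Proof.
have act0 d : act 0 d = 0 by rewrite -(scale0r 0) actZl scale0r.
by congr TrivAlg; rewrite /= ?mul0r // !act0 addr0.
Qed.

Lemma triv_a_mulX alpha beta :
  triv_a alpha * triv_inj (fps_X beta) =
    if (beta <= alpha)%MM then triv_a (alpha - beta)%MM else 0.
Proof.
have -> : triv_a alpha * triv_inj (fps_X beta) =
          TrivAlg 0 (act (fps_X beta) 'X_[alpha]).
  by congr TrivAlg; rewrite /= ?mul0r // linear0 add0r.
rewrite act_X; case: ifP => le_ba.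
  congr TrivAlg; apply/mpolyP => c; rewrite mcoeff_actX mcoeffX /=.
  case: ifP => le_ca.
    congr (nat_of_bool _)%:R; apply/eqP/eqP => <-; apply/mnmP => i;
      rewrite !mnmBE subKn //; exact/mnm_lepP.
  case: eqP => // E; move: le_ca; rewrite -E => /negP[].
  by apply/mnm_lepP => i; rewrite mnmBE leq_subr.
congr TrivAlg; apply/mpolyP => c; rewrite mcoeff_actX mcoeff0 /=.
case: ifP => // le_ca; case: eqP => // E; move: le_ba; rewrite -E => /negP[].
by apply/mnm_lepP => i; rewrite mnmBE leq_subr.
Qed.

Lemma triv_a_mul0 alpha h :
  (forall beta, (mdeg beta <= mdeg alpha)%N -> fcoef h beta = 0) ->
  triv_a alpha * triv_inj h = 0.
Proof.
move=> h0; congr TrivAlg => /=; first by rewrite mul0r.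
rewrite linear0 add0r act_X; apply/mpolyP => c.
by rewrite mcoeff_actX mcoeff0 h0 ?if_same ?mdegB.
Qed.

Lemma triv_tr_a alpha : triv_tr (triv_a alpha) = (alpha == 0%MM)%:R.
Proof. by rewrite /triv_tr mcoeffX. Qed.

Lemma triv_tr_inj h : triv_tr (triv_inj h) = 0.
Proof. by rewrite /triv_tr mcoeff0. Qed.

End TrivialExtension.

(* Main.v *)
(* Let T be the set of the elements of A killed by a power of each variable.
   If a is in A, then x_i^k a = r_i lies in F[[X]] for some k and all i, and
   x_j^k r_i = x_i^k r_j; as n >= 2 and powers of distinct variables are
   coprime, r_i = x_i^k f for a single series f, whence a - f is in T.  So A is
   the direct sum of F[[X]] and T.  Sending u to the functional (. | u)
   identifies T with the distributions, i.e., with the span of the a_alpha.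
   Finally T is divisible, so its product vanishes: if x^k u = 0 and v = x^k w,
   then u v = 0. *)

Require Import Defs.
From HB Require Import structures.
From mathcomp Require Import all_boot all_order all_algebra.
From mathcomp Require Import boolp.
From mathcomp Require Import ssrcomplements mpoly.
From mathcomp Require Import zify.

Set Implicit Arguments.
Unset Strict Implicit.
Unset Printing Implicit Defensive.

Import GRing.Theory.

Local Open Scope ring_scope.

(** * Power series: monomials, division with remainder, functionals of finite support *)

Section PowerSeries.
Variables (F : fieldType) (n : nat).
Implicit Types (f g h : fps F n) (a b : 'X_{1..n}) (i j : 'I_n).

Lemma fcoef_sum (I : Type) (r : seq I) (P : pred I) (G : I -> fps F n) a :
  fcoef (\sum_(i <- r | P i) G i) a = \sum_(i <- r | P i) fcoef (G i) a.
Proof. by elim/big_rec2: _ => // i x y _ <-. Qed.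

Lemma fcoefXM b f a :
  fcoef (fps_X b * f) a = if (b <= a)%MM then fcoef f (a - b)%MM else 0.
Proof.
rewrite (fcoefM _ _ (ltnSn _)).
case: ifP => le_ba; last first.
  rewrite big1 // => k le_ka /=; case: eqP => [E|_]; last by rewrite mul0r.
  by move: le_ba; rewrite -E le_ka.
have hb : (mdeg b < (mdeg a).+1)%N.
  by rewrite ltnS -(submK le_ba) mdegD leq_addl.
rewrite (bigD1 (BMultinom hb)) //= eqxx mul1r big1 ?addr0 // => k /andP[_].
by rewrite -val_eqE /= => /negbTE ->; rewrite mul0r.
Qed.

Lemma fcoefXMD b f a : fcoef (fps_X b * f) (a + b)%MM = fcoef f a.
Proof. by rewrite fcoefXM lem_addl addmK. Qed.

Lemma fps_XD a b : fps_X (a + b)%MM = fps_X a * fps_X b :> fps F n.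
Proof.
apply: fpsP => c; rewrite fcoefXM /=.
case: ifP => le_ac /=.
  congr (nat_of_bool _)%:R; apply/eqP/eqP => [->|<-].
    by rewrite addmC addmK.
  by rewrite addmC submK.
by case: eqP => // E; move: le_ac; rewrite E lem_addr.
Qed.

Lemma fps_XMn a k : fps_X (a *+ k)%MM = fps_X a ^+ k :> fps F n.
Proof.
by elim: k => [|k IHk]; rewrite ?mulm0n // mulmS fps_XD IHk exprS.
Qed.

Lemma fps_XMI b : injective (fun f => fps_X b * f).
Proof. move=> f g /= E; apply: fpsP => a.
by rewrite -(fcoefXMD b f) E fcoefXMD. Qed.

Lemma le_mulUn i k a : (U_(i) *+ k <= a)%MM = (k <= a i)%N.
Proof.
apply/mnm_lepP/idP => [/(_ i)|le_ka j]; rewrite mulmnE mnm1E.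
  by rewrite eqxx mul1n.
by case: eqP => [<-|]; rewrite ?mul1n ?mul0n.
Qed.

Definition fps_restrict (P : pred 'X_{1..n}) f : fps F n :=
  FPS (fun a => if P a then fcoef f a else 0).

Definition fps_shift b f : fps F n := FPS (fun a => fcoef f (a + b)%MM).

(** Division by a monomial: [fps_shift] is the quotient, and the remainder collects the terms that
    $x^b$ does not divide. *)
Lemma fps_division b f :
  f = fps_X b * fps_shift b f + fps_restrict (fun a => ~~ (b <= a)%MM) f.
Proof.
apply: fpsP => a; rewrite fcoefD fcoefXM /=.
by case: ifP => [/submK ->|_]; rewrite ?addr0 ?add0r.
Qed.

(** If $a_i<k$, the coefficient of $f$ at $a$ is that of $x_j^k f=x_i^k g$ at $a+ke_j$. The $i$-th
    exponent there is still $a_i<k$, so the coefficient is zero and $f$ has no remainder modulo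
    $x_i^k$. *)
Lemma fps_X_coprime i j k f g : i != j ->
  fps_X (U_(j) *+ k)%MM * f = fps_X (U_(i) *+ k)%MM * g ->
  exists h, f = fps_X (U_(i) *+ k)%MM * h.
Proof.
move=> ne_ij E; exists (fps_shift (U_(i) *+ k)%MM f).
rewrite {1}(fps_division (U_(i) *+ k)%MM f) -[RHS]addr0; congr (_ + _).
apply: fpsP => a /=; case: ifP => // /negbTE; rewrite le_mulUn => lt_ak.
rewrite -(fcoefXMD (U_(j) *+ k)%MM) E fcoefXM le_mulUn mnmDE mulmnE mnm1E.
by rewrite eq_sym (negbTE ne_ij) mul0n addn0 lt_ak.
Qed.

Lemma fps_finite (P : pred 'X_{1..n}) d f :
  (forall a, P a -> (mdeg a < d)%N) ->
  fps_restrict P f =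
    \sum_(a : 'X_{1..n < d} | P a) fcoef f a *: fps_X (val a).
Proof.
move=> Pd; apply: fpsP => a; rewrite fcoef_sum /=; case: ifP => Pa; last first.
  rewrite big1 // => b Pb /=; case: eqP => [E|_]; last by rewrite mulr0.
  by rewrite E Pb in Pa.
rewrite (bigD1 (BMultinom (Pd a Pa))) //= eqxx mulr1 big1 ?addr0 //.
move=> b /andP[_]; rewrite -val_eqE /= eq_sym => /negbTE ->.
by rewrite mulr0.
Qed.

(** Coefficientwise counterpart of membership in $M^m$. *)
Definition fps_ord_ge m f := forall a, (mdeg a < m)%N -> fcoef f a = 0.

Lemma fps_ord_geM m k f g :
  fps_ord_ge m f -> fps_ord_ge k g -> fps_ord_ge (m + k) (f * g).
Proof.
move=> fm gk a lt_a; rewrite (fcoefM _ _ (ltnSn _)) big1 // => b le_ba.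
have := mdegD (a - b)%MM b; rewrite submK // => Ea.
have [lt_b|le_mb] := ltnP (mdeg b) m; first by rewrite fm ?mul0r.
by rewrite gk ?mulr0 //; lia.
Qed.

Lemma fps_ord_ge_prod (t : seq (fps F n)) :
  all fps_max t -> fps_ord_ge (size t) (\prod_(y <- t) y).
Proof.
elim: t => [|y t IHt] /= => [_ a //|/andP[/eqP y0 tM]].
rewrite big_cons -add1n; apply: fps_ord_geM (IHt tM) => b.
by rewrite ltnS leqn0 mdeg_eq0 => /eqP ->.
Qed.

Lemma ideal_power_ord_ge m h : ideal_power fps_max m h -> fps_ord_ge m h.
Proof.
case=> s sM -> a lt_am; rewrite fcoef_sum big_seq big1 // => u us.
have := fps_ord_ge_prod (sM u us); rewrite size_tuple => um.
exact: (@fps_ord_geM 0 m).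
Qed.

Lemma ideal_power_XM m i h : ideal_power fps_max m (fps_X (U_(i) *+ m)%MM * h).
Proof.
exists [:: (h, nseq_tuple m (fps_X U_(i)%MM))] => [u|].
  rewrite inE => /eqP -> /=; rewrite all_nseq; apply/orP; right.
  by apply/eqP; rewrite /= [_ == _]eq_sym mnm1_eq0.
by rewrite big_seq1 /= big_nseq iter_mulr_1 fps_XMn mulrC.
Qed.

(** The polynomial [d] is read as a functional on series, with $a_\alpha$ extracting the coefficient
    at $\alpha$. *)
Definition mpoly_pair (d : {mpoly F[n]}) h :=
  \sum_(a <- msupp d) d@_a * fcoef h a.

Lemma mpoly_pair_distribution d : distribution (mpoly_pair d).
Proof.
split=> [c f g|]; rewrite /mpoly_pair.
  under eq_bigr do rewrite fcoefD fcoefZ mulrDr mulrCA.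
  by rewrite big_split -mulr_sumr.
(* The support has degrees below [msize d]; the successor keeps the exponent positive when [d] is
   zero. *)
exists (msize d).+1 => // h /ideal_power_ord_ge h0.
rewrite big_seq big1 // => a ad; rewrite h0 ?mulr0 //.
by rewrite ltnS ltnW // msize_mdeg_lt.
Qed.

Lemma mpoly_pair_X d a : mpoly_pair d (fps_X a) = d@_a.
Proof.
rewrite /mpoly_pair; under eq_bigr => b _ do rewrite /=.
have [ad|ad] := boolP (a \in msupp d).
  rewrite (bigD1_seq a) ?msupp_uniq //= eqxx mulr1 big1 ?addr0 //.
  by move=> b /negbTE ->; rewrite mulr0.
rewrite (memN_msupp_eq0 ad) big_seq big1 // => b bd.
case: eqP => [E|_]; last by rewrite mulr0.
by rewrite -E bd in ad.
Qed.

Lemma mpoly_pairE d m h : (msize d <= m)%N ->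
  mpoly_pair d h = \sum_(a : 'X_{1..n < m}) d@_a * fcoef h a.
Proof.
move=> le_dm; pose I : subFinType _ := 'X_{1..n < m}.
rewrite /mpoly_pair (big_mksub I) ?msupp_uniq //=; first last.
  by move=> x /msize_mdeg_lt /leq_trans; apply.
by rewrite big_rmcond //= => j /memN_msupp_eq0 ->; rewrite mul0r.
Qed.

(** Under the pairing, [act f] is the transpose of multiplication by $f$. *)
Lemma mcoeff_act f d a : (act f d)@_a = mpoly_pair d (fps_X a * f).
Proof.
rewrite /act raddf_sum; apply: eq_bigr => b _.
by rewrite fcoefXM /= mcoeffZ mcoeff_actX.
Qed.

End PowerSeries.

(** * The torsion part and its functionals on $F[[X]]$ *)

Section Torsion.
Variables (F : fieldType) (n : nat) (A : traced_ext F n).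
Hypotheses (traceA : trace_extension A) (distA : distributional A).
Local Notation inj := (te_inj A).
Local Notation t := (te_tr A).
Implicit Types (u v w : A) (f g h : fps F n) (a b : 'X_{1..n}) (i j : 'I_n).

Definition killed k u := forall i, inj (fps_X (U_(i) *+ k)%MM) * u = 0.

Definition torsion u := exists k, killed k u.

(** $F[[X]]$ is orthogonal to itself, in particular to $1$. *)
Lemma te_tr_inj h : t (inj h) = 0.
Proof.
have [_ perp _] := traceA.
have /perp/(_ 1) : exists g, inj h = inj g by exists h.
by rewrite /te_form rmorph1 mul1r.
Qed.

Lemma killed_leq k m u : (k <= m)%N -> killed k u -> killed m u.
Proof.
move=> le_km ku i; rewrite fps_XMn -(subnK le_km) exprD -(fps_XMn _ _ k).
by rewrite rmorphM -mulrA ku mulr0.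
Qed.

Lemma torsionP c u v : torsion u -> torsion v -> torsion (c *: u + v).
Proof.
move=> [k ku] [m mv]; exists (maxn k m) => i.
rewrite mulrDr -scalerAr (killed_leq (leq_maxl k m) ku).
by rewrite (killed_leq (leq_maxr k m) mv) scaler0 addr0.
Qed.

Lemma torsionM u v : torsion v -> torsion (u * v).
Proof. by move=> [k kv]; exists k => i; rewrite mulrCA kv mulr0. Qed.

Lemma torsion0 : torsion 0.
Proof. by exists 0 => i; rewrite mulr0. Qed.

Lemma torsionD u v : torsion u -> torsion v -> torsion (u + v).
Proof. by move=> tu tv; rewrite -[u]scale1r; apply: torsionP. Qed.

Lemma torsionB u v : torsion u -> torsion v -> torsion (u - v).
Proof. by move=> tu tv; rewrite addrC -scaleN1r; apply: torsionP. Qed.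

(** Multiplication by $x_i^k$ is injective on series. The index [i] ensures that a variable exists;
    without one, [killed] would be vacuous. *)
Lemma torsion_inj i f : torsion (inj f) -> f = 0.
Proof.
move=> [k /(_ i)]; rewrite -rmorphM -(rmorph0 inj) => /te_injI.
by rewrite -[0 in RHS](mulr0 (fps_X (U_(i) *+ k)%MM)) => /fps_XMI.
Qed.

(** Divide by $x_i^k$ for each $i$ in [s] in turn: the multiples of $x_i^k$ vanish on [u], and only
    the remainders survive. *)
Lemma killed_mul_restrict k u (s : seq 'I_n) h : killed k u ->
  inj h * u = inj (fps_restrict (fun a => all (fun i => a i < k)%N s) h) * u.
Proof.
move=> ku; elim: s h => [|i s IHs] h.
  by congr (inj _ * _); apply: fpsP.
rewrite {1}(fps_division (U_(i) *+ k)%MM h) rmorphD rmorphM mulrDl.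
rewrite mulrAC ku mul0r add0r [LHS]IHs; congr (inj _ * _); apply: fpsP => a /=.
by rewrite le_mulUn -ltnNge; case: (a i < k)%N; rewrite ?if_same.
Qed.

Lemma killed_bound k a : (forall i, a i < k)%N -> (mdeg a < (n * k).+1)%N.
Proof.
move=> ak; rewrite ltnS mdegE -[n in (n * k)%N]card_ord -sum_nat_const.
by apply: leq_sum => i _; apply: ltnW.
Qed.

(** Only the finitely many monomials with all exponents below $k$ act nontrivially on [u], so the
    functional is a finite combination of coefficients, determined by its values on monomials. *)
Lemma torsion_dual u : torsion u ->
  exists d : {mpoly F[n]}, forall h, t (inj h * u) = mpoly_pair d h.
Proof.
move=> [k ku]; pose P a := all (fun i => a i < k)%N (enum 'I_n).
pose D := (n * k).+1.
have PD a : P a -> (mdeg a < D)%N.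
  by move=> /allP Pa; apply: killed_bound => i; apply: Pa; rewrite mem_enum.
pose d := \sum_(a : 'X_{1..n < D} | P a)
             t (inj (fps_X (val a)) * u) *: 'X_[F, a].
exists d => h; rewrite (killed_mul_restrict (enum 'I_n) _ ku).
rewrite (fps_finite _ PD) raddf_sum mulr_suml raddf_sum.
have pairD : mpoly_pair d h = \sum_(a : 'X_{1..n < D} | P a)
   t (inj (fps_X (val a)) * u) * fcoef h a.
  have sd : (msize d <= D)%N.
    apply: (leq_trans (msize_sum _ _ _)); apply/bigmax_leqP => a _.
    by apply: leq_trans (msizeZ_le _ _) _; rewrite msizeX; apply: bmdeg.
  rewrite (mpoly_pairE _ sd) [RHS]big_mkcond; apply: eq_bigr => a _.
  rewrite /d raddf_sum /=; under eq_bigr do rewrite mcoeffZ mcoeffX.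
  case: ifP => Pa.
    rewrite (bigD1 a) //= eqxx mulr1 big1 ?addr0 // => b /andP[_].
    by rewrite -val_eqE /= => /negbTE ->; rewrite mulr0.
  rewrite big1 ?mul0r // => b Pb; case: eqP => [E|]; last by rewrite mulr0.
  by rewrite -E Pb in Pa.
rewrite pairD; apply: eq_bigr => a _.
by rewrite /= linearZ -scalerAl linearZ [RHS]mulrC.
Qed.

(** Orthogonality to the monomials gives orthogonality to all series by [torsion_dual]. Hence [u]
    lies in $F[[X]]^\perp=F[[X]]$, which meets the torsion part in zero. *)
Lemma torsion_dual_eq0 i u :
  torsion u -> (forall a, t (inj (fps_X a) * u) = 0) -> u = 0.
Proof.
move=> tu u0; have [d Ed] := torsion_dual tu.
have d0 : d = 0.
  by apply/mpolyP => a; rewrite mcoeff0 -mpoly_pair_X -Ed.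
have [_ perp _] := traceA; have /perp[f Ef] : forall h, te_form (inj h) u = 0.
  by move=> h; rewrite /te_form Ed d0 /mpoly_pair msupp0 big_nil.
by move: tu; rewrite Ef => /(torsion_inj i) ->; rewrite rmorph0.
Qed.

(** * Splitting $A$ by means of two distinct variables *)

Section Decomposition.
Variables (i0 i1 : 'I_n) (ne01 : i0 != i1).

Lemma torsion_split u : exists f, torsion (u - inj f).
Proof.
have [_ [m _ um]] := distA u; pose X i : fps F n := fps_X (U_(i) *+ m)%MM.
have [_ perp _] := traceA.
(* The functional $(\cdot|u)$ vanishes on $M^m$, which contains $x_i^m h$; so $x_i^m u$ is
   orthogonal to $F[[X]]$. *)
have XuR i : exists f, inj (X i) * u = inj f.
  apply/perp => h; rewrite /te_form mulrCA mulrA -rmorphM.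
  by apply: um; apply: ideal_power_XM.
have /choice[r Er] := XuR.
have rX i j : X j * r i = X i * r j.
  by apply: (@te_injI _ _ A); rewrite !rmorphM /= -!Er mulrCA.
have [f Ef] := fps_X_coprime ne01 (rX i0 i1).
exists f, m => i; rewrite mulrBr Er -rmorphM.
(* The series $f$ comes from [i0] and [i1] only; cancelling $x_{i_0}^m$ extends the relation to
   every $i$. *)
suff -> : r i = X i * f by rewrite subrr.
by apply: (@fps_XMI _ _ (U_(i0) *+ m)%MM); rewrite /= rX Ef mulrCA.
Qed.

(** Some element of $A$ represents the distribution [d]; removing its series part does not change
    the functional, as $t$ vanishes on $F[[X]]$. *)
Lemma torsion_of_dual (d : {mpoly F[n]}) :
  exists2 u, torsion u & forall a, t (inj (fps_X a) * u) = d@_a.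
Proof.
have [_ _ surj] := traceA; have [u Eu] := surj _ (mpoly_pair_distribution d).
have [f tf] := torsion_split u; exists (u - inj f) => // a.
by rewrite mulrBr raddfB -rmorphM /= te_tr_inj subr0 -mpoly_pair_X Eu.
Qed.

(* The torsion part is divisible: write [v = x ^ k * w] where [x ^ k] kills
   [u]. *)
Lemma torsion_mul0 u v : torsion u -> torsion v -> u * v = 0.
Proof.
move=> [k ku] tv; have [d Ed] := torsion_dual tv.
(* Multiplication by the monomial raises the indices of [d], which the action of $x_{i_0}^k$ lowers
   back. *)
have [w tw Ew] := torsion_of_dual (d * 'X_[U_(i0) *+ k]).
suff -> : v = inj (fps_X (U_(i0) *+ k)%MM) * w.
  by rewrite mulrCA mulrA ku mul0r.
apply/eqP; rewrite -subr_eq0; apply/eqP; apply: (torsion_dual_eq0 i0).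
  by apply: torsionB => //; apply: torsionM.
move=> a; rewrite mulrBr raddfB mulrA -rmorphM -fps_XD /= Ed Ew.
by rewrite mpoly_pair_X addmC mcoeffMX subrr.
Qed.

(** The graph of the future isomorphism. As a relation it can be checked on any witness, and
    uniqueness then transfers each property to the chosen function. *)
Definition represents u (p : triv_alg F n) :=
  torsion (u - inj (triv_ser p)) /\
  forall a, t (inj (fps_X a) * u) = (triv_dual p)@_a.

Lemma represents_ex u : exists p, represents u p.
Proof.
have [f tf] := torsion_split u; have [d Ed] := torsion_dual tf.
exists (TrivAlg f d); split=> // a.
rewrite -[u](subrK (inj f)) mulrDr raddfD -rmorphM /= te_tr_inj addr0.
by rewrite Ed mpoly_pair_X.
Qed.

Lemma represents_inv p : exists u, represents u p.
Proof.
have [u tu Eu] := torsion_of_dual (triv_dual p).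
exists (u + inj (triv_ser p)); split=> [|a]; first by rewrite addrK.
by rewrite mulrDr raddfD -rmorphM /= te_tr_inj addr0.
Qed.

Lemma represents_uniq u p q : represents u p -> represents u q -> p = q.
Proof.
case: p q => [f d] [g e] [/= tf Ed] [/= tg Ee].
have -> : d = e by apply/mpolyP => a; rewrite -Ed.
congr TrivAlg; apply/eqP; rewrite -subr_eq0; apply/eqP/(torsion_inj i0).
by have := torsionB tg tf; rewrite opprB addrC addrA subrK -rmorphB.
Qed.

Lemma represents_linear c u v p q :
  represents u p -> represents v q -> represents (c *: u + v) (c *: p + q).
Proof.
move=> [tu Eu] [tv Ev]; split=> [|a] /=.
  rewrite linearP opprD addrACA -scalerBr; exact: torsionP.
by rewrite mulrDr -scalerAr linearP /= Eu Ev mcoeffD mcoeffZ.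
Qed.

Lemma represents0_inj u : represents u 0 -> u = 0.
Proof.
move=> [] /=; rewrite rmorph0 subr0 => tu Eu.
by apply: (torsion_dual_eq0 i0) => // a; rewrite Eu mcoeff0.
Qed.

Lemma represents_faithful u v p : represents u p -> represents v p -> u = v.
Proof.
move=> up vp; apply/eqP; rewrite -subr_eq0; apply/eqP/represents0_inj.
by have := represents_linear (-1) vp up; rewrite !scaleN1r addrC addNr.
Qed.

(** The series part of [u] is invisible to the trace, so [torsion_dual] extends the pairing with [u]
    from monomials to all series; [mcoeff_act] concludes. *)
Lemma represents_act f p u : represents u p ->
  forall a, t (inj (fps_X a * f) * u) = (act f (triv_dual p))@_a.
Proof.
move=> [tu Eu] a; have [d Ed] := torsion_dual tu.
have Eh h : t (inj h * u) = mpoly_pair d h.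
  by rewrite -Ed mulrBr raddfB -rmorphM /= te_tr_inj subr0.
have -> : triv_dual p = d by apply/mpolyP => b; rewrite -Eu Eh mpoly_pair_X.
by rewrite mcoeff_act Eh.
Qed.

(** Let $f$, $g$ be the series parts of $u$, $v$. Then $uv-fg=(u-f)v+f(v-g)$ is torsion. Since
    $(u-f)(v-g)=0$, also $uv=fv+gu-fg$, and the trace kills the multiples of $fg$ by monomials,
    leaving the two actions in the product of the trivial extension. *)
Lemma represents_mul u v p q :
  represents u p -> represents v q -> represents (u * v) (p * q).
Proof.
move=> up vq; have [[tu Eu] [tv Ev]] := (up, vq).
split=> [|a] /=.
  rewrite rmorphM -[u * v](subrK (inj (triv_ser p) * v)) -mulrBl -addrA -mulrBr.
  by apply: torsionD; [rewrite mulrC|]; apply: torsionM.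
have /eqP := torsion_mul0 tu tv; rewrite mulrBl subr_eq0 mulrBr => /eqP Euv.
rewrite -[u * v](subrK (u * inj (triv_ser q))) Euv mulrBr -rmorphM.
rewrite mulrDr mulrBr !raddfD raddfN /= -[inj _ * inj _]rmorphM te_tr_inj.
rewrite subr0 [u * _]mulrC !mulrA -!rmorphM.
by rewrite (represents_act _ up) (represents_act _ vq).
Qed.

Lemma represents_te_inj h : represents (inj h) (triv_inj h).
Proof.
split=> [|a] /=; first by rewrite subrr; apply: torsion0.
by rewrite -rmorphM te_tr_inj mcoeff0.
Qed.

End Decomposition.
End Torsion.

(** * The isomorphism with the trivial extension *)

Theorem theorem3p1 (F : closedFieldType) (charF : [pchar F] =i pred0)
    (n : nat) (n_ge2 : (2 <= n)%N) (A : traced_ext F n)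
    (traceA : trace_extension A) (distA : distributional A) :
  te_iso A (trivial_ext F n).
Proof.
pose i0 := Ordinal (ltnW n_ge2); pose i1 := Ordinal n_ge2.
have ne01 : i0 != i1 by [].
have /choice[g gP] := represents_ex traceA distA ne01.
have /choice[g' g'P] := represents_inv traceA distA ne01.
have gE u p : represents u p -> g u = p.
  by move=> up; apply: (represents_uniq i0 (gP u) up).
have gL : linear g.
  by move=> c u v; apply/gE/represents_linear.
have gM : monoid_morphism g.
  split=> [|u v]; last exact/gE/(represents_mul traceA distA ne01).
  by apply: gE; rewrite -(rmorph1 (te_inj A)); apply: represents_te_inj.
pose gl := GRing.isLinear.Build F A (trivial_ext F n) _ g gL.
pose gm := GRing.isMonoidMorphism.Build A (trivial_ext F n) g gM.
pose G : {lrmorphism A -> trivial_ext F n} := HB.pack g gl gm.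
(* The scalar is $1$: $t(u)=t(x^0u)$ is already the coefficient at $a_0$. *)
exists G, 1; split.
- exists g' => [u|p]; last exact: gE.
  by apply: (represents_faithful traceA i0 (g'P (g u))).
- by move=> h; apply/gE/represents_te_inj.
- exact: oner_neq0.
- move=> u; rewrite mul1r; have [_ /(_ 0%MM)] := gP u.
  by rewrite [fps_X 0%MM]/(1 : fps F n) rmorph1 mul1r => ->.
Qed.
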